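(* Let $M$ be a $C^k$-Fréchet manifold ($k\ge 4$) modeled on a Fréchet space $F$, let $\mathcal S$ be a spray on $M$ of class at least $C^2$, let $g\colon I\subset\mathbb R\to M$ be a geodesic of $\mathcal S$ defined on an interval $I$, and let $S\subset M$ be a non-empty closed subset. Let $A_{\mathcal S,S}\subset TM$ be the $(T^2S,\mathcal S)$-admissible set. Then $g(t)\in S$ for all $t\in I$ if and only if $g'(t)\in A_{\mathcal S,S}$ for all $t\in I$.
   Context: Manifolds are Hausdorff. $F$ is a real Fréchet space whose topology is given by a countable family of continuous seminorms $\|\cdot\|_n$, $n\in\mathbb N$; for $x\in F$, $B\subset F$ put $d_n(x,B)=\inf_{y\in B}\|x-y\|_n$. $C^k$ is understood in the Michal–Bastiani sense: a map between open subsets of Fréchet spaces is $C^k$ if it is continuous, all iterated directional derivatives up to order $k$ exist, and they are jointly continuous in the point and the directions. $\tau\colon TM\to M$ and $\tau_2\colon T(TM)\to TM$ are the tangent bundles, and $f_*=Tf$ denotes the tangent map. Spray: a $C^r$-map $\mathcal S\colon TM\to T(TM)$ ($r\le k-2$) with $\tau_*\circ\mathcal S=\mathrm{Id}_{TM}$, $\tau_2\circ\mathcal S=\mathrm{Id}_{TM}$ and $\mathcal S(sv)=(L_s)_*(s\,\mathcal S(v))$ for all $s\in\mathbb R$, $v\in TM$, where $L_s\colon TM\to TM$, $L_s(v)=sv$, is fibrewise scalar multiplication. In a chart $\mathcal S(x,v)=(x,v,v,\mathcal S_2(x,v))$ with $\mathcal S_2(x,sv)=s^2\mathcal S_2(x,v)$.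 A geodesic of $\mathcal S$ is a curve $g\colon I\to M$ whose canonical lift $g'\colon I\to TM$ is an integral curve of $\mathcal S$, i.e. $g''=\mathcal S(g')$. Adjacent cone: for $S\subset M$, $s\in S$, the set $T_sS$ consists of all $v\in T_sM$ such that for some chart $(U,\varphi)$ around $s$, $\lim_{t\to0^+}t^{-1}d_n(\varphi(s)+t\,D\varphi(s)(v),\varphi(U\cap S))=0$ for all $n$. Second-order adjacent tangent vectors: for $s\in S$ and $v\in T_sS$, a vector $w\in T_v(TM)$ belongs to $T^2_sS$ (with associated vector $v$) if for some chart $(U,\varphi)$ about $s$, writing $v_\varphi=D\varphi(s)(v)$ and $(w_1,w_2)\in F\times F$ for the local representation of $w$ in the chart $T\varphi$ of $TM$, one has (i) $w_1=v_\varphi$ and (ii) $\lim_{t\to0^+}t^{-2}d_n(\varphi(s)+tv_\varphi+\tfrac12t^2w_2,\varphi(U\cap S))=0$ for all $n\in\mathbb N$. Admissible set: $A_{\mathcal S,S}=\{v\in TM : \tau(v)\in S \text{ and } \mathcal S(v)\in T^2_{\tau(v)}S\}$.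
   Formalization: The interval I is required to have no last point (e.g. open or [a,b)); if I contains its right endpoint the claim fails: M = R, zero spray, g(t) = t on I = [0,1], S = [0,1], where g'(1) is not admissible. *)

(* Defs.v *)
From HB Require Import structures.
From mathcomp Require Import all_boot all_order all_algebra.
From mathcomp Require Import all_classical all_reals all_analysis.
Set Implicit Arguments.
Unset Strict Implicit.
Unset Printing Implicit Defensive.
Import Order.TTheory GRing.Theory Num.Theory.
Import numFieldTopology.Exports numFieldNormedType.Exports.
Local Open Scope classical_set_scope.
Local Open Scope ring_scope.

(* [p] is a sequence of seminorms generating the topology of the Frechet space
   [F].  Completeness is expressed with the seminorms and not with the uniform
   structure of [F], because a [tvsType] only requires its uniform structure to
   induce the topology. *)
Record frechet_seminorms (R : realType) (F : tvsType R) (p : nat -> F -> R) :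
    Prop := {
  seminormD : forall n x y, p n (x + y) <= p n x + p n y ;
  seminormZ : forall n (a : R) x, p n (a *: x) = `|a| * p n x ;
  seminorm_nbhs : forall (x : F) (W : set F), nbhs x W <->
    exists N : nat, exists2 e : R, 0 < e &
      forall y, (forall n, (n < N)%N -> p n (y - x) < e) -> W y ;
  frechet_hausdorff : hausdorff_space F ;
  frechet_complete : forall u : nat -> F,
    (forall n (e : R), 0 < e -> exists N : nat, forall i j,
       (N <= i)%N -> (N <= j)%N -> p n (u i - u j) < e) ->
    exists l : F, u @ \oo --> l }.

Section MichalBastiani.
Context {R : realType} {E G : tvsType R}.
Implicit Types (f : E -> G) (x v : E).

Definition is_dderiv f x v (w : G) : Prop :=
  h^-1 *: (f (x + h *: v) - f x) @[h --> (0 : R)^'] --> w.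

Definition dderiv f v x : G := xget 0 [set w | is_dderiv f x v w].

Fixpoint iter_dderiv f (hs : seq E) : E -> G :=
  if hs is h :: hs' then dderiv (iter_dderiv f hs') h else f.

(* Meaningful for [U] open: only the values of [f] on [U] matter then. *)
Definition Ck_on (k : nat) (U : set E) f : Prop :=
  (forall (hs : seq E) h x, (size hs < k)%N -> U x ->
     exists w, is_dderiv (iter_dderiv f hs) x h w) /\
  (forall j : nat, (j <= k)%N ->
     {within [set z : E * 'rV[E]_j | U z.1], continuous
       (fun z : E * 'rV[E]_j =>
          iter_dderiv f [seq z.2 ord0 i | i <- enum 'I_j] z.1)}).

End MichalBastiani.

(* The bare data of an atlas; [chart A i] is only relevant on [dom A i]. *)
Record atlas (R : realType) (E : tvsType R) (M : topologicalType) := Atlas {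
  idx : Type ;
  dom : idx -> set M ;
  chart : idx -> M -> E }.

Section Atlas.
Context {R : realType} {E G : tvsType R} {M N : topologicalType}.

(* [chart B j \o f \o (chart A i)^-1], extended by 0. *)
Definition local_rep (A : atlas E M) (B : atlas G N) (f : M -> N)
    (i : idx A) (j : idx B) (y : E) : G :=
  xget 0 [set z | exists x, [/\ dom i x, dom j (f x),
                                chart i x = y & chart j (f x) = z]].

Definition Ck_map (k : nat) (A : atlas E M) (B : atlas G N) (f : M -> N) :
    Prop :=
  continuous f /\
  forall (i : idx A) (j : idx B),
    Ck_on k (chart i @` (dom i `&` f @^-1` dom j)) (local_rep f i j).

End Atlas.

(* The atlas is not required to be maximal, so this covers the maximal one. *)
Record Ck_manifold (R : realType) (E : tvsType R) (M : topologicalType)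
    (k : nat) (A : atlas E M) : Prop := {
  manifold_hausdorff : hausdorff_space M ;
  manifold_cover : forall x : M, exists i : idx A, dom i x ;
  manifold_dom : forall i : idx A, open (dom i) ;
  manifold_inj : forall (i : idx A) x y,
    dom i x -> dom i y -> chart i x = chart i y -> x = y ;
  manifold_continuous : forall i : idx A, {within dom i, continuous (chart i)} ;
  manifold_open : forall (i : idx A) (W : set M),
    open W -> W `<=` dom i -> open (chart i @` W) ;
  manifold_transition : forall i j : idx A,
    Ck_on k (chart i @` (dom i `&` dom j)) (local_rep id i j) }.

(* A tangent vector is a point together with the family of its local
   representatives in all charts around that point, related by the derivatives
   of the transition maps; [tcomp v i] is D(chart i)(v).  The value 0 in the
   other charts makes the family unique. *)
Record tangent (R : realType) (E : tvsType R) (M : topologicalType)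
    (A : atlas E M) := Tangent {
  tpt : M ;
  tcomp : idx A -> E ;
  tcomp_out : forall i, ~ dom i tpt -> tcomp i = 0 ;
  tcomp_coherent : forall i j, dom i tpt -> dom j tpt ->
    is_dderiv (local_rep id i j) (chart i tpt) (tcomp i) (tcomp j) }.

Section TangentBundle.
Context {R : realType} {E : tvsType R} {M : topologicalType}.
Variable A : atlas E M.

HB.instance Definition _ := gen_eqMixin (tangent A).
HB.instance Definition _ := gen_choiceMixin (tangent A).

Definition tchart (i : idx A) (v : tangent A) : E * E :=
  (chart i (tpt v), tcomp v i).

(* The manifold topology of the tangent bundle: the coarsest one for which the
   [tchart i] have open domains and are continuous there. *)
Definition tangent_subbase : set (set (tangent A)) :=
  [set W | exists (i : idx A) (O : set (E * E)), open O /\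
     W = [set v | dom i (tpt v) /\ O (tchart i v)]].

HB.instance Definition _ :=
  isSubBaseTopological.Build (tangent A) tangent_subbase id.

Definition tangent_atlas : atlas (E * E)%type (tangent A) :=
  @Atlas R (E * E)%type (tangent A) (idx A)
    (fun i => [set v | dom i (tpt v)]) tchart.

Lemma is_dderivZ (G : tvsType R) (f : E -> G) (x v : E) (w : G) (s : R) :
  is_dderiv f x v w -> is_dderiv f x (s *: v) (s *: w).
Proof.
move=> fw; rewrite /is_dderiv; have [->|s0] := eqVneq s 0.
  rewrite !scale0r; under eq_fun do rewrite scaler0 addr0 subrr scaler0.
  exact: cvg_cst.
have -> : (fun h : R => h^-1 *: (f (x + h *: (s *: v)) - f x)) =
    (fun z : R^o * G => z.1 *: z.2) \o
    (fun h => (s, (h * s)^-1 *: (f (x + (h * s) *: v) - f x))).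
  apply/funext => h /=; rewrite !scalerA invfM mulrCA mulfV ?mulr1//.
apply: (@cvg_comp _ _ _ _ _ _ (nbhs ((s : R^o), w))); last first.
  exact: (@scale_continuous R G ((s : R^o), w)).
apply: (@cvg_pair _ _ _ _ (nbhs (s : R^o)) (nbhs w)); first exact: cvg_cst.
apply: (@cvg_comp _ _ _ (fun h : R => h * s)
  (fun h => h^-1 *: (f (x + h *: v) - f x)) (0 : R)^' (0 : R)^'); last exact: fw.
move=> W W0.
have hs : h * s @[h --> (0 : R)] --> (0 : R).
  by rewrite -[X in _ --> X](mul0r s); exact: mulrr_continuous.
have {}W0 := hs _ W0.
apply: (@filterS _ (nbhs (0 : R)) _ _ _ _ W0) => h Wh h0.
by apply: Wh; rewrite mulf_neq0.
Qed.

Lemma tscale_out (s : R) (v : tangent A) (i : idx A) :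
  ~ dom i (tpt v) -> s *: tcomp v i = 0.
Proof. by move=> /tcomp_out ->; rewrite scaler0. Qed.

Lemma tscale_coherent (s : R) (v : tangent A) (i j : idx A) :
  dom i (tpt v) -> dom j (tpt v) ->
  is_dderiv (local_rep id i j) (chart i (tpt v))
    (s *: tcomp v i) (s *: tcomp v j).
Proof. by move=> di dj; apply/is_dderivZ/tcomp_coherent. Qed.

Definition tscale (s : R) (v : tangent A) : tangent A :=
  Tangent (@tscale_out s v) (@tscale_coherent s v).

End TangentBundle.

(* [w = f_*(v)] *)
Definition is_tangent_map (R : realType) (E G : tvsType R)
    (M N : topologicalType) (A : atlas E M) (B : atlas G N) (f : M -> N)
    (v : tangent A) (w : tangent B) : Prop :=
  tpt w = f (tpt v) /\
  forall (i : idx A) (j : idx B), dom i (tpt v) -> dom j (f (tpt v)) ->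
    is_dderiv (local_rep f i j) (chart i (tpt v)) (tcomp v i) (tcomp w j).

Section Sprays.
Context {R : realType} {F : tvsType R} {M : topologicalType}.
Variable A : atlas F M.
Local Notation TM := (tangent A).
Local Notation TTM := (tangent (tangent_atlas A)).

Record spray (r : nat) (sp : TM -> TTM) : Prop := {
  spray_Ck : Ck_map r (tangent_atlas A) (tangent_atlas (tangent_atlas A)) sp ;
  spray_tau : forall v, is_tangent_map (@tpt R F M A) (sp v) v ;
  spray_tau2 : forall v, tpt (sp v) = v ;
  spray_scale : forall (s : R) v,
    is_tangent_map (@tscale R F M A s) (tscale s (sp v)) (sp (tscale s v)) }.

End Sprays.

(* [c'] is the velocity of the curve [c] on the interval [I]; the values of
   [c] and [c'] outside [I] are irrelevant. *)
Definition is_velocity (R : realType) (E : tvsType R) (M : topologicalType)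
    (A : atlas E M) (I : set R) (c : R -> M) (c' : R -> tangent A) : Prop :=
  {within I, continuous c} /\
  forall t, I t -> tpt (c' t) = c t /\
    forall i : idx A, dom i (c t) ->
      (s - t)^-1 *: (chart i (c s) - chart i (c t)) @[s --> within I t^']
        --> tcomp (c' t) i.

(* [g] is a geodesic of [sp] on [I] with canonical lift [g']. *)
Definition geodesic (R : realType) (F : tvsType R) (M : topologicalType)
    (A : atlas F M) (sp : tangent A -> tangent (tangent_atlas A)) (I : set R)
    (g : R -> M) (g' : R -> tangent A) : Prop :=
  is_velocity I g g' /\ is_velocity I g' (sp \o g').

(* The adjacent conditions look forward in time, so they do not make sense for
   the velocity at a last point of [I]: for g(t) = t on [0, 1], the zero spray
   of the real line and S = [0, 1], the vector g'(1) is not adjacent to S.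
   Every open interval satisfies this definition. *)
Definition forward_interval (R : realType) (I : set R) : Prop :=
  is_interval I /\ forall t, I t -> exists2 u, I u & t < u.

Section AdjacentCones.
Context {R : realType} {F : tvsType R} {M : topologicalType}.
Variables (p : nat -> F -> R) (A : atlas F M).
Local Notation TM := (tangent A).
Local Notation TTM := (tangent (tangent_atlas A)).
Implicit Type S : set M.

Definition dist (n : nat) (x : F) (B : set F) : R :=
  inf [set p n (x - y) | y in B].

Definition adjacent_cone S (s : M) : set TM :=
  [set v : TM | [/\ S s, tpt v = s & exists2 i : idx A, dom i s &
    forall n, t^-1 * dist n (chart i s + t *: tcomp v i)
                            (chart i @` (dom i `&` S))
      @[t --> (0 : R)^'+] --> (0 : R)]].

Definition adjacent_cone2 S (s : M) : set TTM :=
  [set w : TTM | adjacent_cone S s (tpt w) /\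
    exists2 i : idx A, dom i s &
      let v := tcomp (tpt w) i in
      let w12 : F * F := tcomp w i in
      w12.1 = v /\
      forall n, t ^- 2 * dist n (chart i s + t *: v + (t ^+ 2 / 2) *: w12.2)
                                (chart i @` (dom i `&` S))
        @[t --> (0 : R)^'+] --> (0 : R)].

Definition admissible (sp : TM -> TTM) S : set TM :=
  [set v : TM | S (tpt v) /\ adjacent_cone2 S (tpt v) (sp v)].

End AdjacentCones.

(* Main.v *)
(** Only one implication has content.  In a chart [phi], the curve
    [c = phi \o g] of a geodesic running in [S] has velocity the component of
    [g'], and acceleration the second component of the spray along [g'], so
    Taylor's formula at order two gives
    [c (t + h) = c t + h c' t + h^2/2 c'' t + o(h^2)] in every seminorm.  As
    [c (t + h)] lies in [phi (dom phi `&` S)], this is the second-order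
    adjacency of [c'' t].  The remainder is estimated by a mean value inequality
    for seminorms, which needs neither integration nor duality. *)
Require Import Defs.
From mathcomp Require Import all_boot all_order all_algebra.
From mathcomp Require Import all_classical all_reals all_analysis.
From mathcomp Require Import ring lra.
Set Implicit Arguments.
Unset Strict Implicit.
Unset Printing Implicit Defensive.
Import Order.TTheory GRing.Theory Num.Theory.
Import numFieldTopology.Exports numFieldNormedType.Exports.
Local Open Scope classical_set_scope.
Local Open Scope ring_scope.

(* The mean value inequality, for [D x y = p (f y - f x)]. *)
Lemma locally_lipschitz_bound (R : realType) (D : R -> R -> R) (K a b : R) :
  (forall x y z, D x z <= D x y + D y z) -> (forall x y, D x y = D y x) ->
  a <= b ->
  (forall z, a <= z <= b -> exists2 d : R, 0 < d &
     forall y, a <= y <= b -> `|y - z| < d -> D z y <= K * `|y - z|) ->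
  D a b <= K * (b - a).
Proof.
move=> Dtri Dsym ab Dloc.
(* The points up to which the bound holds from [a]. Their supremum [c] belongs to [B] by the local
   estimate at [c], and if [c < b] the same estimate puts a larger point in [B]. *)
pose B := [set s | a <= s <= b /\ D a s <= K * (s - a)].
have Ba : B a.
  split; first by rewrite lexx.
  have [|d d0 /(_ a)] := Dloc a; first by rewrite lexx.
  by rewrite lexx subrr normr0 => /(_ ab d0).
have Bub : ubound B b by move=> s [] /andP[].
have supB : has_sup B by split; [exists a|exists b].
set c := sup B.
have ac : a <= c by apply: ub_le_sup => //; exists b.
have cb : c <= b by apply: ge_sup => //; exists a.
have [|d d0 Dc] := Dloc c; first by rewrite ac.
have Bc : D a c <= K * (c - a).
  have [s [/andP[a_s sb] Ds] cs] := sup_adherent d0 supB.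
  have sc : s <= c by apply: ub_le_sup; [exists b|split=> //; rewrite a_s].
  have := Dc s; rewrite a_s sb distrC ger0_norm ?subr_ge0// => /(_ isT).
  rewrite -/c in cs; rewrite ltrBlDr -ltrBlDl => /(_ cs) Dcs.
  have := Dtri a s c; rewrite (Dsym s c); lra.
have [<-//|cneb] := eqVneq c b.
have {}cneb : c < b by rewrite lt_neqAle cneb.
(* The halved radius keeps [s] strictly within [d] of [c], and the minimum keeps it in the
   interval. *)
pose s := Num.min b (c + d / 2).
have cs : c < s by rewrite lt_min cneb ltrDl divr_gt0.
have sd : s <= c + d / 2 by rewrite ge_min lexx orbT.
have sb : s <= b by rewrite ge_min lexx.
have a_s : a <= s by apply: le_trans ac (ltW cs).
suff : s <= c by rewrite leNgt cs.
apply: ub_le_sup; [by exists b|split; first by rewrite a_s].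
have := Dc s; rewrite a_s sb ger0_norm ?subr_ge0 ?(ltW cs)// => /(_ isT).
have -> : s - c < d by lra.
move=> /(_ isT) Dcs; have := Dtri a c s; lra.
Qed.

(** * Seminorm estimates and the second-order Taylor formula *)

Section Seminorms.
Context {R : realType} {F : tvsType R} {p : nat -> F -> R}.
Hypothesis hF : frechet_seminorms p.
Implicit Types (n : nat) (x y : F) (I : set R) (c : R -> F).

Lemma seminorm0 n : p n 0 = 0.
Proof. by rewrite -[X in p n X](scale0r 0) (seminormZ hF) normr0 mul0r. Qed.

Lemma seminormN n x : p n (- x) = p n x.
Proof. by rewrite -scaleN1r (seminormZ hF) normrN1 mul1r. Qed.

Lemma seminorm_ge0 n x : 0 <= p n x.
Proof.
have := seminormD hF n x (- x); rewrite subrr seminorm0 seminormN; lra.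
Qed.

Lemma dist_ge0 n x (B : set F) : 0 <= dist p n x B.
Proof.
(* The infimum of the empty set is 0 by convention. *)
have [->|B0] := eqVneq B set0; first by rewrite /dist image_set0 inf0.
apply: lb_le_inf; last by move=> _ [y _ <-]; exact: seminorm_ge0.
by move/set0P : B0 => [y By]; exists (p n (x - y)), y.
Qed.

Lemma dist_le n x y (B : set F) : B y -> dist p n x B <= p n (x - y).
Proof.
move=> By; apply: ge_inf; last by exists y.
by exists 0 => _ [z _ <-]; exact: seminorm_ge0.
Qed.

Lemma seminorm_cvg (T : Type) (Fl : set_system T) {FFl : Filter Fl}
    (u : T -> F) (l : F) n (e : R) :
  u @ Fl --> l -> 0 < e -> \forall x \near Fl, p n (u x - l) < e.
Proof.
move=> ul e0; apply: (ul [set y | p n (y - l) < e]).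
(* The basic neighbourhoods bound the seminorms of index below [N], so index [n] calls for
   [N = n.+1]. *)
by apply/(seminorm_nbhs hF); exists n.+1, e => // y; apply.
Qed.

(** Multiplying the difference quotient by [s - t] gives a first-order expansion in one seminorm.
    The punctured filter leaves out [s = t], where both sides vanish. *)
Lemma derive_within_seminorm I c (t : R) (l : F) n (e : R) :
  (s - t)^-1 *: (c s - c t) @[s --> within I t^'] --> l -> 0 < e ->
  exists2 d : R, 0 < d & forall s, I s -> `|s - t| < d ->
    p n (c s - c t - (s - t) *: l) <= e * `|s - t|.
Proof.
move=> cl e0; have /nbhs_ballP[d /= d0 dP] : nbhs t (fun s => s != t -> I s ->
    p n ((s - t)^-1 *: (c s - c t) - l) < e).
  exact: (@seminorm_cvg _ (within I t^') _ _ l n e cl e0).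
exists d => // s Is sd.
have [->|st] := eqVneq s t.
  by rewrite !subrr scale0r subrr seminorm0 normr0 mulr0.
have := dP s; rewrite /ball /= distrC => /(_ sd st Is).
have st0 : s - t != 0 by rewrite subr_eq0.
have -> : c s - c t - (s - t) *: l =
    (s - t) *: ((s - t)^-1 *: (c s - c t) - l).
  by rewrite scalerBr scalerA divff// scale1r.
rewrite (seminormZ hF) => /ltW pe.
by rewrite mulrC ler_wpM2r.
Qed.

(** The remainder [rem] vanishes at [t] and has derivative [c1 z - c1 t - (z - t) *: w] plus a term
    that is [- (z - t) *: w] accounted for once, that is, [A1]; differentiability of [c1] at [t]
    bounds this by [e / 2 * h] on [[t, t + h]]. The mean value inequality with [K = e * h]
    concludes. *)
Lemma taylor2_seminorm I c (c1 : R -> F) (t b : R) (w : F) n (e : R) :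
  t < b -> (forall s, t <= s <= b -> I s) ->
  (forall s, t <= s <= b ->
     (u - s)^-1 *: (c u - c s) @[u --> within I s^'] --> c1 s) ->
  (s - t)^-1 *: (c1 s - c1 t) @[s --> within I t^'] --> w ->
  0 < e ->
  exists2 d : R, 0 < d & forall h : R, 0 < h < d ->
    p n (c (t + h) - c t - h *: c1 t - (h ^+ 2 / 2) *: w) <= e * h ^+ 2.
Proof.
move=> tb tbI cc1 c1w e0.
have e20 : 0 < e / 2 by rewrite divr_gt0.
have [d d0 c1P] := derive_within_seminorm n c1w e20.
exists (Num.min d (b - t)); first by rewrite lt_min d0 subr_gt0.
move=> h; rewrite lt_min => /and3P[h0 hd hb].
pose rem s := c s - c t - (s - t) *: c1 t - ((s - t) ^+ 2 / 2) *: w.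
have rem_t : rem t = 0.
  by rewrite /rem !subrr scale0r expr0n /= mul0r scale0r !subr0.
have -> : c (t + h) - c t - h *: c1 t - (h ^+ 2 / 2) *: w =
    rem (t + h) - rem t by rewrite rem_t subr0 /rem [t + h]addrC addrK.
have -> : e * h ^+ 2 = e * h * (t + h - t) by ring.
rewrite -seminormN opprB.
apply: (@locally_lipschitz_bound R (fun r s => p n (rem r - rem s))).
- by move=> x y z; rewrite (le_trans _ (seminormD hF _ _ _))// addrA subrK.
- by move=> x y; rewrite -seminormN opprB.
- by rewrite lerDl ltW.
move=> z /andP[tz zh].
have zb : t <= z <= b by rewrite tz /=; lra.
(* The constant [e * h] is shared out: one half for [A1], one quarter for the first-order error [A2]
   of [c] at [z], one quarter for the quadratic term in [w]. *)
have eh0 : 0 < e * h / 4 by rewrite divr_gt0// mulr_gt0.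
have [d1 d10 cP] := derive_within_seminorm n (cc1 z zb) eh0.
have pw0 := seminorm_ge0 n w.
(* Within this radius [(y - z) ^+ 2 / 2 *: w] stays below its quarter; the added 1 covers
   [p n w = 0]. *)
pose d2 := e * h / (2 * (p n w + 1)).
have d20 : 0 < d2.
  by rewrite divr_gt0 ?mulr_gt0//; lra.
exists (Num.min d1 d2); first by rewrite lt_min d10.
move=> y /andP[ty yh]; rewrite lt_min => /andP[yd1 yd2].
have yb : t <= y <= b by rewrite ty /=; lra.
have := cP y (tbI _ yb) yd1.
have : p n (c1 z - c1 t - (z - t) *: w) <= e / 2 * h.
  have := c1P z (tbI _ zb); rewrite ger0_norm ?subr_ge0//.
  have -> : z - t < d by lra.
  move=> /(_ isT) /le_trans; apply.
  by rewrite ler_wpM2l ?(ltW e20)//; lra.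
set A1 := _ - _ - _ *: w; set A2 := _ - _ - _ *: c1 z => A1P A2P.
(* This rests on [(y - t) ^+ 2 - (z - t) ^+ 2 = (y - z) ^+ 2 + 2 * (y - z) * (z - t)]. *)
have -> : rem z - rem y =
    - (A2 + (y - z) *: A1 - ((y - z) ^+ 2 / 2) *: w).
  have subACA (x1 x2 x3 x4 : F) : x1 - x2 - (x3 - x4) = x1 - x3 - (x2 - x4).
    by rewrite opprD addrACA -opprD.
  have -> : A2 + (y - z) *: A1 = c y - c z - (y - z) *: c1 t -
      ((y - z) * (z - t)) *: w.
    by rewrite /A1 !scalerBr scalerA !addrA subrK.
  rewrite -[_ - _ *: w - _ *: w]addrA -opprD -scalerDl /rem.
  rewrite subACA [X in X - _ = _]subACA [c z - c t - _]subACA.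
  rewrite subrr subr0 -[_ *: c1 t - _]scalerBl -[_ *: w - _]scalerBl.
  rewrite !opprD !opprK -[- (_ *: c1 t)]scaleNr -[- (_ *: w)]scaleNr.
  by congr (_ + _ *: _ + _ *: _); [rewrite addrC|ring|field].
rewrite seminormN.
have := seminormD hF n (A2 + (y - z) *: A1) (- (((y - z) ^+ 2 / 2) *: w)).
have := seminormD hF n A2 ((y - z) *: A1).
rewrite seminormN !(seminormZ hF) => H1 H2.
have ny := normr_ge0 (y - z).
have H3 : `|y - z| * p n A1 <= `|y - z| * (e / 2 * h) by rewrite ler_wpM2l.
have H4 : `|(y - z) ^+ 2 / 2| * p n w <= `|y - z| * (e * h / 4).
  rewrite normrM normrX [`|2^-1|]ger0_norm ?invr_ge0//.
  rewrite expr2 -!mulrA ler_wpM2l//.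
  have : `|y - z| * (p n w + 1) <= e * h / 2.
    rewrite -ler_pdivlMr; last lra.
    by move: yd2; rewrite /d2 invfM mulrA => /ltW.
  nra.
nra.
Qed.

End Seminorms.

(** * One-sided limits and filters on intervals *)

Lemma cvg0_right_of_le (R : realType) (f : R -> R) (m : nat) :
  (forall h : R, 0 <= f h) ->
  (forall e : R, 0 < e -> exists2 d : R, 0 < d &
     forall h : R, 0 < h < d -> f h <= e * h ^+ m) ->
  h ^- m * f h @[h --> (0 : R)^'+] --> (0 : R).
Proof.
move=> f0 fP; apply/cvgrPdist_le => e e0.
have [d d0 dP] := fP e e0.
near=> h; have h0 : 0 < h by near: h; exact: nbhs_right_gt.
rewrite sub0r normrN ger0_norm ?mulr_ge0 ?invr_ge0 ?exprn_ge0 ?(ltW h0)//.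
rewrite mulrC ler_pdivrMr ?exprn_gt0//; apply: dP; rewrite h0/=.
by near: h; exact: nbhs_right_lt.
Unshelve. all: by end_near. Qed.

Lemma near_within_ball (R : realType) (I : set R) (t : R) (P : R -> Prop) :
  (\forall s \near within I (nbhs t), P s) ->
  exists2 d : R, 0 < d & forall s, I s -> `|s - t| < d -> P s.
Proof.
move=> tP; have /nbhs_ballP[d /= d0 dP] : nbhs t (fun s => I s -> P s) by [].
exists d => // s Is sd.
by apply: dP => //; rewrite /ball /= distrC.
Qed.

(** Convexity fills the gap between [t] and a later point of [I], so [I] accumulates at [t] from the
    right. Properness is what makes velocities unique. *)
Lemma forward_interval_proper (R : realType) (I : set R) (t : R) :
  forward_interval I -> I t -> ProperFilter (within I t^').
Proof.
move=> [itvI fwd] It; apply: Build_ProperFilter_ex => P tP.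
have [u Iu tu] := fwd t It.
have /nbhs_ballP[d /= d0 dP] : nbhs t (fun s => s != t -> I s -> P s) by [].
pose s := Num.min u (t + d / 2).
have ts : t < s by rewrite lt_min tu ltrDl divr_gt0.
have sd : s <= t + d / 2 by rewrite ge_min lexx orbT.
have su : s <= u by rewrite ge_min lexx.
exists s; apply: dP.
- rewrite /ball /= distrC gtr0_norm ?subr_gt0//; lra.
- by rewrite gt_eqF.
- by apply: (itvI t u It Iu); rewrite su ltW.
Qed.

(** * Curves read in a chart *)

Section Geodesics.
Context {R : realType} {F : tvsType R} {M : topologicalType}.
Variables (p : nat -> F -> R) (A : atlas F M).
Hypotheses (hF : frechet_seminorms p) (domA : forall i : idx A, open (dom i)).
Variables (I : set R) (hI : forward_interval I).

Lemma velocity_near_dom (c : R -> M) (c' : R -> tangent A) t (i : idx A) :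
  is_velocity I c c' -> I t -> dom i (c t) ->
  exists b, t < b /\ forall s, t <= s <= b -> I s /\ dom i (c s).
Proof.
move=> [cI _] It it; have [itvI fwd] := hI; have [u Iu tu] := fwd t It.
have : \forall s \near within I (nbhs t), dom i (c s).
  have /subspace_continuousP := cI; apply => //.
  by apply: open_nbhs_nbhs; split=> //; exact: domA.
move=> /near_within_ball[d d0 dP].
exists (Num.min u (t + d / 2)); split; first by rewrite lt_min tu ltrDl divr_gt0.
move=> s /andP[ts]; rewrite le_min => /andP[su sd].
have Is : I s by apply: (itvI t u It Iu); rewrite ts su.
split=> //; apply: dP => //.
by rewrite ger0_norm ?subr_ge0//; lra.
Qed.

(** The point [c (t + h)] lies in [S], and in the chart it is [o(h)] away from the first-order
    expansion of [c] at [t]. *)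
Lemma velocity_adjacent_cone (c : R -> M) (c' : R -> tangent A)
    (S : set M) t :
  (forall x : M, exists i : idx A, dom i x) ->
  is_velocity I c c' -> I t -> (forall s, I s -> S (c s)) ->
  adjacent_cone p S (c t) (c' t).
Proof.
move=> cover cc' It cS; have [i it] := cover (c t).
have [ct vt] := cc'.2 t It.
split; [exact: cS|exact: ct|exists i => // n].
have [b [tb bP]] := velocity_near_dom cc' It it.
(* Puts the quotient in the form of [cvg0_right_of_le] with [m = 1]. *)
under eq_fun => h do rewrite -[h^-1]/(h ^- 1).
apply: cvg0_right_of_le; first by move=> h; exact: dist_ge0 hF _ _ _.
move=> e e0.
have [d d0 dP] := derive_within_seminorm hF n (vt i it) e0.
exists (Num.min d (b - t)); first by rewrite lt_min d0 subr_gt0.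
move=> h; rewrite lt_min => /and3P[h0 hd hb].
have [Ih ih] : I (t + h) /\ dom i (c (t + h)).
  by apply: bP; rewrite lerDl (ltW h0)/=; lra.
have Bh : (chart i @` (dom i `&` S)) (chart i (c (t + h))).
  by exists (c (t + h)) => //; split=> //; exact: cS.
apply: le_trans (dist_le hF _ _ Bh) _.
have := dP (t + h) Ih; rewrite [t + h]addrC addrK gtr0_norm// expr1 => /(_ hd).
by rewrite -addrA -opprD -(seminormN hF) opprB.
Qed.

End Geodesics.

(** * Geodesics and the admissible set *)

Theorem theorem2p15 (R : realType) (F : tvsType R) (p : nat -> F -> R)
    (hF : frechet_seminorms p)
    (M : topologicalType) (A : atlas F M) (k r : nat)
    (hk : (4 <= k)%N) (hM : Ck_manifold k A)
    (hr : (2 <= r)%N) (hrk : (r <= k - 2)%N)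
    (sp : tangent A -> tangent (tangent_atlas A)) (hsp : spray r sp)
    (I : set R) (hI : forward_interval I)
    (g : R -> M) (g' : R -> tangent A) (hg : geodesic sp I g g')
    (S : set M) (hS0 : S !=set0) (hS : closed S) :
  (forall t, I t -> S (g t)) <->
  (forall t, I t -> admissible p sp S (g' t)).
Proof.
have [gv gv'] := hg.
split=> [gS t It|adm t It]; last first.
  (* Admissibility already contains that the base point of [g' t], which is [g t], lies in [S]. *)
  by have [+ _] := adm t It; rewrite (gv.2 t It).1.
have gt := (gv.2 t It).1; have spt := (gv'.2 t It).1.
rewrite /admissible/=; split; first by rewrite gt; exact: gS.
rewrite gt; split.
  rewrite spt.
  exact (velocity_adjacent_cone hF (manifold_dom hM) hI
    (manifold_cover hM) gv It gS).
have [i it] := manifold_cover hM (g t).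
have [b [tb bP]] := velocity_near_dom (manifold_dom hM) hI gv It it.
exists i => //=; rewrite spt.
(* In the chart [tchart i] the lift is the pair of [chart i (g s)] and [tcomp (g' s) i], so the two
   components of [w] are the derivatives of these two curves at [t]. *)
have vel2 := (gv'.2 t It).2 i; rewrite /= gt in vel2; have {}vel2 := vel2 it.
set w := tcomp (sp (g' t)) i in vel2 *.
have PF := forward_interval_proper hI It.
have vel2_1 : (s - t)^-1 *: (chart i (g s) - chart i (g t))
    @[s --> within I t^'] --> (w : F * F).1.
  apply: cvg_trans (cvg_comp _ _ vel2 (@cvg_fst _ _ (nbhs w.1) (nbhs w.2) _)).
  apply: near_eq_cvg; apply: (@filterE _ t^') => s Is /=.
  by rewrite (gv.2 s Is).1 gt.
have vel2_2 : (s - t)^-1 *: (tcomp (g' s) i - tcomp (g' t) i)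
    @[s --> within I t^'] --> (w : F * F).2.
  exact: (cvg_comp _ _ vel2 (@cvg_snd _ _ (nbhs w.1) (nbhs w.2) _)).
split.
  (* Condition (i): [w.1] and the component of [g' t] are limits of the same difference quotient. *)
  apply: (cvg_unique _ vel2_1 ((gv.2 t It).2 i it)).
  exact: frechet_hausdorff hF.
move=> n; apply: cvg0_right_of_le; first by move=> h; exact: dist_ge0 hF _ _ _.
move=> e e0.
have [] := @taylor2_seminorm _ _ _ hF I (chart i \o g) (fun s => tcomp (g' s) i)
  t b w.2 n e tb _ _ vel2_2 e0.
- by move=> s /bP[].
- by move=> s /bP[Is is_]; exact: (gv.2 s Is).2.
move=> d d0 dP; exists (Num.min d (b - t)); first by rewrite lt_min d0 subr_gt0.
move=> h; rewrite lt_min => /and3P[h0 hd hb].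
have [Ih ih] : I (t + h) /\ dom i (g (t + h)).
  by apply: bP; rewrite lerDl (ltW h0)/=; lra.
(* Condition (ii): the distance is tested against the point of the geodesic itself, which the Taylor
   estimate controls. *)
have Bh : (chart i @` (dom i `&` S)) (chart i (g (t + h))).
  by exists (g (t + h)) => //; split=> //; exact: gS.
apply: le_trans (dist_le hF _ _ Bh) _.
have := dP h; rewrite h0 hd => /(_ isT).
by rewrite /= -addrA -opprD -addrA -opprD -(seminormN hF) opprB addrA.
Qed.
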